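(* Let $L$ be a locally compact, noncompact Hausdorff space and $(f_n)_n$ a bounded sequence in $\mathcal{C}_0(L)$. Let $K=L\cup\{\infty\}$ be the one-point compactification of $L$, regard each $f_n$ as defined on $K$ by setting $f_n(\infty)=0$, and define $a,b:K\to\mathbb{R}$ by $$b(t)=\sup\Big\{\lim_{(n,\alpha)}\ \sup_{j\ge n,\ \beta\ge\alpha} f_j(t_\beta) : (t_\alpha)_{\alpha\in\Lambda}\text{ is a net in } K\text{ converging to } t\Big\},$$ $$a(t)=\inf\Big\{\lim_{(n,\alpha)}\ \inf_{j\ge n,\ \beta\ge\alpha} f_j(t_\beta) : (t_\alpha)_{\alpha\in\Lambda}\text{ is a net in } K\text{ converging to } t\Big\},$$ where the limits are taken along the directed set $\mathbb{N}\times\Lambda$ with the product order. Then $a$ is lower semicontinuous, $b$ is upper semicontinuous, and for every $f\in\mathcal{C}(K)$ we have $$\limsup_n\|f_n-f\|=\max\{\|b-f\|,\|f-a\|\}.$$ Consequently the asymptotic radius of $(f_n)_n$ in $\mathcal{C}_0(L)$ is $\max\{b(\infty),-a(\infty),\frac12\|b-a\|\}$ and its asymptotic center in $\mathcal{C}_0(L)$ is the set $$\Big\{g\in\mathcal{C}_0(L):\ \max\{\|b-g\|,\|g-a\|\}=\max\{b(\infty),-a(\infty),\tfrac12\|b-a\|\}\Big\},$$ which is nonempty.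
   Context: $\mathcal{C}(K)$ is the real Banach space of continuous functions $K\to\mathbb{R}$ with the supremum norm. $\mathcal{C}_0(L)$ is the real Banach space, with the supremum norm, of continuous functions $f:L\to\mathbb{R}$ such that $\{t\in L:|f(t)|\ge\varepsilon\}$ is compact for every $\varepsilon>0$; its elements are identified with the continuous functions on $K$ vanishing at $\infty$. $\|\cdot\|$ also denotes the supremum norm of arbitrary bounded real functions on $K$. For a bounded sequence $\bar x=(x_n)_n$ in a normed space $X$, its asymptotic radius is $ar(\bar x)=\inf_{y\in X}\limsup_n\|x_n-y\|$ and its asymptotic center is the set $ac(\bar x)=\{y\in X:\limsup_n\|x_n-y\|=ar(\bar x)\}$. *)

(* Defs.v *)
From HB Require Import structures.
From mathcomp Require Import all_boot all_order all_algebra.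
From mathcomp Require Import all_classical all_reals all_analysis.
From mathcomp Require Import lra.

Set Implicit Arguments.
Unset Strict Implicit.
Unset Printing Implicit Defensive.

Import Order.TTheory GRing.Theory Num.Theory numFieldNormedType.Exports.

Local Open Scope classical_set_scope.
Local Open Scope ring_scope.

(* Meaningful for bounded [h]; equal to 0 when [T] is empty. *)
Definition supnorm (R : realType) (T : Type) (h : T -> R) : R :=
  sup (range (fun t => `|h t|)).

Section supnorm_theory.
Variables (R : realType) (T : Type).
Implicit Types f g h : T -> R.

Definition sup_bounded h := exists M : R, forall t, `|h t| <= M.

Lemma supnorm_ge h t : sup_bounded h -> `|h t| <= supnorm h.
Proof.
move=> [M hM]; apply: ub_le_sup; last by exists t.
by exists M => _ [s _ <-].
Qed.

Lemma supnorm_ge0 h : 0 <= supnorm h.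
Proof.
have [hs|hs] := pselect (has_sup (range (fun t => `|h t|))); last first.
  by rewrite /supnorm sup_out.
have [[_ [t _ _]] bh] := hs.
by apply: (@le_trans _ _ `|h t|) => //; apply: ub_le_sup => //; exists t.
Qed.

Lemma supnorm_le h (M : R) :
  0 <= M -> (forall t, `|h t| <= M) -> supnorm h <= M.
Proof.
move=> M0 hM; rewrite /supnorm.
have [->|/set0P ne] := eqVneq (range (fun t => `|h t|)) set0.
  by rewrite sup0.
by apply: ge_sup => // _ [t _ <-].
Qed.

Lemma supnormD f g : sup_bounded f -> sup_bounded g ->
  supnorm (f \+ g) <= supnorm f + supnorm g.
Proof.
move=> bf bg; apply: supnorm_le; first by rewrite addr_ge0 ?supnorm_ge0.
move=> t; apply: le_trans (ler_normD _ _) _.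
by rewrite lerD ?supnorm_ge.
Qed.

Lemma supnormZ (c : R) f : sup_bounded f ->
  supnorm (c \*: f) = `|c| * supnorm f.
Proof.
move=> bf; have leZ (d : R) h : sup_bounded h ->
    supnorm (d \*: h) <= `|d| * supnorm h.
  move=> bh; apply: supnorm_le; first by rewrite mulr_ge0 ?supnorm_ge0.
  by move=> t /=; rewrite normrZ ler_wpM2l ?supnorm_ge.
apply/eqP; rewrite eq_le leZ//=; have [->|c0] := eqVneq c 0.
  by rewrite normr0 mul0r supnorm_ge0.
have bcf : sup_bounded (c \*: f).
  by move: bf => [M fM]; exists (`|c| * M) => t /=; rewrite normrZ ler_wpM2l.
have {1}-> : f = c^-1 \*: (c \*: f).
  by apply/funext => t /=; rewrite scalerA mulVf// scale1r.
rewrite -ler_pdivlMl ?normr_gt0// -normfV.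
exact: leZ.
Qed.

End supnorm_theory.

Definition vanishes_at_infinity (R : realType) (L : topologicalType)
    (f : L -> R) :=
  forall e : R, 0 < e -> compact [set t | e <= `|f t|].

Definition C0_pred (R : realType) (L : topologicalType) : {pred L -> R} :=
  mem [set f : L -> R | continuous f /\ vanishes_at_infinity f].

Record C0 (R : realType) (L : topologicalType) := MkC0 {
  C0_val :> L -> R ;
  C0_valP : C0_val \in @C0_pred R L }.

Section C0_lmodule.
Variables (R : realType) (L : topologicalType).

HB.instance Definition _ := [isSub for @C0_val R L].
HB.instance Definition _ := [Choice of C0 R L by <:].

Let closed_levels (f : L -> R) (e : R) :
  continuous f -> closed [set t | e <= `|f t|].
Proof.
move=> cf; have -> : [set t | e <= `|f t|] =
    (fun t => `|f t|) @^-1` [set x : R | e <= x] by [].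
apply: closed_comp; last exact: closed_ge.
by move=> t _; apply: continuous_comp; [exact: cf|exact: norm_continuous].
Qed.

Let C0_submod_closed : submod_closed (@C0_pred R L).
Proof.
split.
  rewrite inE; split; first exact: cst_continuous.
  move=> e e0; rewrite (_ : [set _ | _] = set0); first exact: compact0.
  by apply/seteqP; split=> t //=; rewrite normr0 leNgt e0.
move=> c f g; rewrite !inE => -[cf vf] [cg vg].
have ch : continuous (c *: f + g).
  by move=> t; apply: cvgD; [exact: cvgZr (cf t)|exact: cg].
split=> // e e0.
pose A := [set t | e / 2 / (`|c| + 1) <= `|f t|] `|` [set t | e / 2 <= `|g t|].
apply: (@subclosed_compact _ _ A); first exact: closed_levels.
  by apply: compactU; [apply: vf|apply: vg]; rewrite ?divr_gt0// ltr_wpDl.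
move=> t /= eh.
have [eg|ge] := leP (e / 2) `|g t|; [by right|left => /=].
have c1 : 0 < `|c| + 1 by rewrite ltr_wpDl.
rewrite ler_pdivrMr//.
have : e <= `|c| * `|f t| + `|g t|.
  by apply: le_trans eh _; apply: le_trans (ler_normD _ _) _; rewrite normrM.
have : 0 <= `|f t| by [].
move: ge; rewrite mulrDr mulr1 [`|f t| * _]mulrC [X in _ < X -> _]splitr.
lra.
Qed.

HB.instance Definition _ :=
  GRing.isSubmodClosed.Build R (L -> R) (@C0_pred R L) C0_submod_closed.
HB.instance Definition _ := [SubChoice_isSubLmodule of C0 R L by <:].

Lemma C0_bounded (f : C0 R L) : sup_bounded f.
Proof.
have := C0_valP f; rewrite inE => -[cf vf].
have cA := vf 1 ltr01.
have /compact_bounded[M [_ hM]] : compact (f @` [set t | 1 <= `|f t|]).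
  by apply: continuous_compact => //; exact: continuous_subspaceT.
exists (Num.max 1 (`|M| + 1)) => t; rewrite le_max.
have [f1|f1] := leP 1 `|f t|; last by rewrite ltW.
apply/orP; right; apply: (hM (`|M| + 1)); last by exists t.
by rewrite (le_lt_trans (ler_norm M))// ltrDl.
Qed.

Definition C0_norm (f : C0 R L) : R := supnorm f.

Let C0_normD (f g : C0 R L) : C0_norm (f + g) <= C0_norm f + C0_norm g.
Proof. exact: (supnormD (C0_bounded f) (C0_bounded g)). Qed.

Let C0_normZ (c : R) (f : C0 R L) : C0_norm (c *: f) = `|c| * C0_norm f.
Proof. exact: (supnormZ c (C0_bounded f)). Qed.

Let C0_norm0_eq0 (f : C0 R L) : C0_norm f = 0 -> f = 0.
Proof.
move=> f0; apply/val_inj/funext => t /=; apply/eqP.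
by rewrite -normr_le0 -f0; exact/supnorm_ge/C0_bounded.
Qed.

HB.instance Definition _ := Lmodule_isNormed.Build R (C0 R L)
  C0_normD C0_normZ C0_norm0_eq0.

End C0_lmodule.

Section asymptotic.
Variables (R : realType) (X : normedModType R).

Definition asymptotic_radius (x : nat -> X) : R :=
  inf [set limn_sup (fun n => `|x n - y|) | y in [set: X]].

Definition asymptotic_center (x : nat -> X) : set X :=
  [set y | limn_sup (fun n => `|x n - y|) = asymptotic_radius x].

End asymptotic.

Record directedType := DirectedType {
  dir_sort :> Type ;
  dir_le : dir_sort -> dir_sort -> Prop ;
  dir_inhabited : inhabited dir_sort ;
  dir_refl : forall i, dir_le i i ;
  dir_trans : forall j i k, dir_le i j -> dir_le j k -> dir_le i k ;
  dir_directed : forall i j, exists2 k, dir_le i k & dir_le j k }.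

Definition nat_directed : directedType.
Proof.
apply: (@DirectedType nat (fun m n => (m <= n)%N)) => //.
- exact: (inhabits 0%N).
- by move=> n m p; exact: leq_trans.
- by move=> m n; exists (maxn m n); rewrite ?leq_maxl ?leq_maxr.
Defined.

Definition prod_directed (D E : directedType) : directedType.
Proof.
apply: (@DirectedType (D * E)
    (fun p q => dir_le p.1 q.1 /\ dir_le p.2 q.2)).
- by have [d] := dir_inhabited D; have [e] := dir_inhabited E.
- by move=> p; split; exact: dir_refl.
- by move=> q p r [pq1 pq2] [qr1 qr2]; split; [exact: dir_trans pq1 qr1|exact: dir_trans pq2 qr2].
- move=> p q.
  have [d pd qd] := dir_directed p.1 q.1.
  have [e pe qe] := dir_directed p.2 q.2.
  by exists (d, e).
Defined.

(* A net [x : D -> T] converges to [t] when [x @ tails D --> t]. *)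
Definition tails (D : directedType) : set_system D :=
  filter_from [set: D] (fun i => [set j | dir_le i j]).
Arguments tails : clear implicits.

Global Instance tails_proper_filter (D : directedType) : ProperFilter (tails D).
Proof.
apply: filter_from_proper; last by move=> i _; exists i; exact: dir_refl.
apply: filter_from_filter; first by have [i] := dir_inhabited D; exists i.
move=> i j _ _; have [k ik jk] := dir_directed i j.
by exists k => // l /= kl; split; exact: dir_trans kl.
Qed.

Section net_limits.
Variables (R : realType) (K : topologicalType) (f : nat -> K -> R).

Definition net_limsup (D : directedType) (x : D -> K) : R :=
  lim ((fun p : prod_directed nat_directed D =>
          sup [set f j (x k) | j in [set j | (p.1 <= j)%N]
                             & k in [set k | dir_le p.2 k]])
       @ tails (prod_directed nat_directed D)).

Definition net_liminf (D : directedType) (x : D -> K) : R :=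
  lim ((fun p : prod_directed nat_directed D =>
          inf [set f j (x k) | j in [set j | (p.1 <= j)%N]
                             & k in [set k | dir_le p.2 k]])
       @ tails (prod_directed nat_directed D)).

Definition upper_envelope (t : K) : R :=
  sup [set l | exists (D : directedType) (x : D -> K),
                 x @ tails D --> t /\ l = net_limsup x].

Definition lower_envelope (t : K) : R :=
  inf [set l | exists (D : directedType) (x : D -> K),
                 x @ tails D --> t /\ l = net_liminf x].

End net_limits.

(* Dual of the library's [lower_semicontinuous]. *)
Definition upper_semicontinuous (X : topologicalType) (R : numFieldType)
    (f : X -> \bar R) :=
  forall x a, (f x < a%:E)%E ->
    exists2 V, nbhs x V & forall y, V y -> (f y < a%:E)%E.

(* The point at infinity of [one_point_compactification L] is [None]. *)
Definition zero_at_infinity (R : realType) (L : topologicalType) (g : L -> R) :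
    one_point_compactification L -> R :=
  fun s => if s is Some t then g t else 0.

(* Main.v *)
Require Import Defs.
From HB Require Import structures.
From mathcomp Require Import all_boot all_order all_algebra.
From mathcomp Require Import all_classical all_reals all_analysis.
From mathcomp Require Import lra.

Set Implicit Arguments.
Unset Strict Implicit.
Unset Printing Implicit Defensive.

Import Order.TTheory GRing.Theory Num.Theory numFieldNormedType.Exports.

Local Open Scope classical_set_scope.
Local Open Scope ring_scope.

(** One has b(t) < c iff f_j <= c' on a neighbourhood of t for all large j and
    some c' < c; semicontinuity is then immediate, and covering the compact space
    K by such neighbourhoods gives
    limsup ||f_n - g|| <= max(||b - g||, ||g - a||).
    Evaluating this maximum at infinity and using b - a = (b - g) + (g - a) shows
    that it is at least r for g vanishing at infinity. The value r is attained by
    any continuous g with g(oo) = 0 and b - r <= g <= a + r; it exists by the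
    Katetov-Tong insertion theorem, since b - r and a + r stay upper (lower)
    semicontinuous when their values at infinity are replaced by 0. *)

(** * Limits superior of a sequence of functions along a net *)

Section nets.
Variable R : realType.

Lemma antitone_net_cvg (D : directedType) (u : D -> R) (m : R) :
  (forall i j, dir_le i j -> u j <= u i) -> (forall i, m <= u i) ->
  u @ tails D --> inf (range u).
Proof.
move=> u_anti um.
have [i0] := dir_inhabited D.
have lbu : has_lbound (range u) by exists m => _ [i _ <-].
have hiu : has_inf (range u) by split=> //; exists (u i0); exists i0.
apply/cvgrPdist_le => e e0.
have [_ [i _ <-] ui] := inf_adherent e0 hiu.
exists i => // j /= ij.
have uj := u_anti _ _ ij.
have lj : inf (range u) <= u j by apply: ge_inf => //; exists j.
rewrite distrC ger0_norm ?subr_ge0// lerBlDl.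
exact: le_trans uj (ltW ui).
Qed.

Definition tail_sup (K : topologicalType) (f : nat -> K -> R)
    (D : directedType) (x : D -> K) (p : prod_directed nat_directed D) : R :=
  sup [set f j (x k) | j in [set j | (p.1 <= j)%N]
                     & k in [set k | dir_le p.2 k]].

(** Moving the index forward shrinks the set under the supremum, so the tail suprema decrease, and
    [- M] bounds them below. Hence the [lim] in [net_limsup] is a genuine limit, not a default
    value. *)
Lemma tail_sup_cvg (K : topologicalType) (f : nat -> K -> R) (M : R)
    (D : directedType) (x : D -> K) : (forall n t, `|f n t| <= M) ->
  tail_sup f x @ tails (prod_directed nat_directed D) -->
    inf (range (tail_sup f x)).
Proof.
move=> fM.
have ubS p : has_ubound [set f j (x k) | j in [set j | (p.1 <= j)%N]
                       & k in [set k | dir_le p.2 k]].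
  by exists M => _ [j _ [k _ <-]]; exact: le_trans (ler_norm _) (fM _ _).
apply: (@antitone_net_cvg (prod_directed nat_directed D) _ (- M)).
  move=> [n d] [n' d'] [/= nn' dd']; apply: ge_sup.
    by exists (f n' (x d')), n' => //=; exists d' => //; exact: dir_refl.
  move=> _ [j /= n'j [k /= d'k <-]]; apply: (ub_le_sup (ubS (n, d))).
  exists j => /=; first exact: leq_trans nn' n'j.
  by exists k => //=; exact: dir_trans dd' d'k.
move=> [n d] /=; apply: (@le_trans _ _ (f n (x d))).
  by have := fM n (x d); rewrite ler_norml => /andP[].
apply: (ub_le_sup (ubS (n, d))); exists n => //=; exists d => //.
exact: dir_refl.
Qed.

Lemma net_limsupE (K : topologicalType) (f : nat -> K -> R) (M : R)
    (D : directedType) (x : D -> K) : (forall n t, `|f n t| <= M) ->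
  net_limsup f x = inf (range (tail_sup f x)).
Proof. by move=> fM; apply/cvg_lim => //; exact: tail_sup_cvg fM. Qed.

Lemma net_limsup_le (K : topologicalType) (f : nat -> K -> R) (M c : R)
    (D : directedType) (x : D -> K) : (forall n t, `|f n t| <= M) ->
  (\forall k \near tails D & j \near \oo, f j (x k) <= c) ->
  net_limsup f x <= c.
Proof.
move=> fM [[A B] /= [[d _ dA] [n _ nB]] AB]; rewrite (net_limsupE _ fM).
apply: (@le_trans _ _ (tail_sup f x (n, d))).
  apply: ge_inf; last by exists (n, d).
  exists (- M) => _ [[n' d'] _ <-]; apply: (@le_trans _ _ (f n' (x d'))).
    by have := fM n' (x d'); rewrite ler_norml => /andP[].
  apply: ub_le_sup.
    by exists M => _ [j _ [k _ <-]]; exact: le_trans (ler_norm _) (fM _ _).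
  by exists n' => //=; exists d' => //; exact: dir_refl.
apply: ge_sup.
  by exists (f n (x d)), n => //=; exists d => //; exact: dir_refl.
move=> _ [j /= nj [k /= dk <-]]; apply: (AB (k, j)); split => /=.
  exact: dA.
exact: nB.
Qed.

(** Values at least [c] need only occur frequently: each tail supremum then dominates [c], and so
    does their infimum. *)
Lemma net_limsup_ge (K : topologicalType) (f : nat -> K -> R) (M c : R)
    (D : directedType) (x : D -> K) : (forall n t, `|f n t| <= M) ->
  (forall n d, exists j k, [/\ (n <= j)%N, dir_le d k & c <= f j (x k)]) ->
  c <= net_limsup f x.
Proof.
move=> fM cf; rewrite (net_limsupE _ fM); apply: lb_le_inf.
  by have [d] := dir_inhabited D; eexists; exists (0%N, d).
move=> _ [[n d] _ <-] /=; have [j [k [nj dk cfjk]]] := cf n d.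
apply: le_trans cfjk _; apply: ub_le_sup; last by exists j => //; exists k.
by exists M => _ [j' _ [k' _ <-]]; exact: le_trans (ler_norm _) (fM _ _).
Qed.

(** Reverse inclusion is the order, so that a net picking a point of each neighbourhood converges to
    [t]. *)
Definition nbhs_directed (K : topologicalType) (t : K) : directedType.
Proof.
apply: (@DirectedType {U : set K | nbhs t U}
  (fun U V => projT1 V `<=` projT1 U)).
- by constructor; exists setT; exact: filterT.
- by move=> U s.
- by move=> V U W UV VW s /VW /UV.
- move=> [U tU] [V tV]; have tUV : nbhs t (U `&` V) by exact: filterI.
  by exists (exist _ _ tUV) => s [].
Defined.

End nets.

(** * Local description and semicontinuity of the envelopes *)

Section envelopes.
Variables (R : realType) (K : topologicalType) (f : nat -> K -> R) (M : R).
Hypothesis fM : forall n t, `|f n t| <= M.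

Lemma net_limsup_bounds (D : directedType) (x : D -> K) :
  - M <= net_limsup f x <= M.
Proof.
apply/andP; split.
  apply: (net_limsup_ge fM) => n d; exists n, d; split => //.
    exact: dir_refl.
  by have := fM n (x d); rewrite ler_norml => /andP[].
apply: (net_limsup_le fM); exists (setT, setT).
  by split; exact: filterT.
move=> [k j] _ /=.
by have := fM j (x k); rewrite ler_norml => /andP[].
Qed.

Lemma upper_envelope_le t c :
  (\forall s \near t & j \near \oo, f j s <= c) -> upper_envelope f t <= c.
Proof.
move=> [[A B] /= [tA noB] AB]; apply: ge_sup.
  (* The constant net shows that the set of limits is nonempty, as the bound on its [sup]
     requires. *)
  exists (net_limsup f (fun _ : nat_directed => t)), nat_directed, (cst t).
  by split=> //; exact: cvg_cst.
move=> _ [D [x [xt ->]]]; apply: (net_limsup_le fM).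
exists (x @^-1` A, B); first by split => //; exact: xt.
by move=> [k j] [/= Ak Bj]; apply: (AB (x k, j)).
Qed.

Lemma upper_envelope_ge t (D : directedType) (x : D -> K) :
  x @ tails D --> t -> net_limsup f x <= upper_envelope f t.
Proof.
move=> xt; apply: ub_le_sup; last by exists D, x.
by exists M => _ [E [y [_ ->]]]; have /andP[] := net_limsup_bounds y.
Qed.

(** Otherwise every neighbourhood [U] of [t] and every [n] admit a point of [U] and an index
    [j >= n] with [f j > c] there. Choosing such points for all pairs [(n, U)] yields a net that
    converges to [t] and has limit superior at least [c]. *)
Lemma near_upper_envelope t c : upper_envelope f t < c ->
  \forall s \near t & j \near \oo, f j s <= c.
Proof.
move=> btc; apply: contrapT => nP.
have ex (p : prod_directed nat_directed (nbhs_directed t)) :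
    {sj : K * nat | [/\ projT1 p.2 sj.1, (p.1 <= sj.2)%N & c <= f sj.2 sj.1]}.
  apply: cid; case: p => n [U tU] /=; apply: contrapT => nex; apply: nP.
  exists (U, [set j | (n <= j)%N]).
    by split=> //; exists n.
  move=> [s j] [/= Us nj]; rewrite leNgt; apply/negP => cf; apply: nex.
  by exists (s, j); split => //=; exact: ltW.
pose x p := (projT1 (ex p)).1.
suff : c <= upper_envelope f t by rewrite leNgt btc.
apply: (@le_trans _ _ (net_limsup f x)); last first.
  apply: upper_envelope_ge => U tU; exists (0%N, exist _ U tU) => //.
  move=> [n [V tV]] [/= _ VU]; apply: VU.
  by rewrite /x; case: (ex _) => -[s j] [].
apply: (net_limsup_ge fM) => n [m U].
(* The net index [(maxn m n, U)] lies beyond [(m, U)], and the function index chosen there is at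
   least [n]. *)
have [xU le_j cf_j] := projT2 (ex (maxn m n, U)).
exists (projT1 (ex (maxn m n, U))).2, (maxn m n, U); split => //.
- exact: leq_trans (leq_maxr _ _) le_j.
- by split => //=; exact: leq_maxl.
Qed.

(** A bound by the midpoint of [upper_envelope f t] and [c] holds on an open set [U] around [t]. As
    [U] is a neighbourhood of each of its points, the bound passes to the envelope on [U]; the
    midpoint keeps the inequality with [c] strict. *)
Lemma near_upper_envelope_lt t c : upper_envelope f t < c ->
  \forall s \near t, upper_envelope f s < c.
Proof.
move=> btc; have btd : upper_envelope f t < (upper_envelope f t + c) / 2 by lra.
have [[A B] /= [tA noB] AB] := near_upper_envelope btd.
have := tA; rewrite nbhsE => -[U [oU Ut] UA].
apply: filterS (open_nbhs_nbhs (conj oU Ut)) => s Us.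
apply: (@le_lt_trans _ _ ((upper_envelope f t + c) / 2)); last by lra.
apply: upper_envelope_le; exists (U, B).
  by split=> //=; exact: open_nbhs_nbhs.
by move=> [r j] [/= Ur Bj]; apply: (AB (r, j)); split => //; exact: UA.
Qed.

Lemma upper_envelope_bounds t : - M <= upper_envelope f t <= M.
Proof.
apply/andP; split.
  have ct : cst t @ tails nat_directed --> t by exact: cvg_cst.
  apply: le_trans (upper_envelope_ge ct).
  by have /andP[] := net_limsup_bounds (cst t : nat_directed -> K).
apply: upper_envelope_le; exists (setT, setT).
  by split; exact: filterT.
move=> [s j] _ /=.
by have := fM j s; rewrite ler_norml => /andP[].
Qed.

Lemma net_liminfE (D : directedType) (x : D -> K) :
  net_liminf f x = - net_limsup (fun n t => - f n t) x.
Proof.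
have NfM n t : `|- f n t| <= M by rewrite normrN.
rewrite (net_limsupE _ NfM) /net_liminf.
have -> : (fun p : prod_directed nat_directed D =>
    inf [set f j (x k) | j in [set j | (p.1 <= j)%N]
      & k in [set k | dir_le p.2 k]]) = (fun p => - tail_sup (fun n t => - f n t) x p).
  apply/funext => p; rewrite /inf /tail_sup; congr (- sup _).
  apply/seteqP; split => [_ [_ [j nj [k dk <-]] <-]|_ [j nj [k dk <-]]].
    by exists j => //; exists k.
  by exists (f j (x k)) => //; exists j => //; exists k.
apply/cvg_lim => //; apply: cvgN.
exact: tail_sup_cvg NfM.
Qed.

(** This duality carries every fact on upper envelopes over to lower ones, by passing to [- f]. *)
Lemma lower_envelopeE t :
  lower_envelope f t = - upper_envelope (fun n t => - f n t) t.
Proof.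
rewrite /lower_envelope /upper_envelope /inf; congr (- sup _).
apply/seteqP; split => [_ [_ [D [x [xt ->]]] <-]|_ [D [x [xt ->]]]].
  by exists D, x; rewrite net_liminfE opprK.
exists (net_liminf f x); first by exists D, x.
by rewrite net_liminfE opprK.
Qed.

End envelopes.

(** * Insertion of a continuous function between semicontinuous ones *)

Section insertion.
Variables (R : realType) (T : topologicalType).
Hypothesis T_compact : compact [set: T].
Hypothesis T_regular : completely_regular_space T.

(** Passing to the interior of [V] makes the complement closed, so that complete regularity
    applies. *)
Lemma separating_function (t : T) (V : set T) : nbhs t V ->
  exists phi : T -> R, [/\ continuous phi, (forall s, 0 <= phi s <= 1),
    phi t = 0 & forall s, ~ V s -> phi s = 1].
Proof.
move=> tV.
have clB : closed (~` V^°) by exact/open_closedC/open_interior.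
have nBt : ~ (~` V^°) t by apply: contrapT => /contrapT; apply.
have /(@uniform_separatorP _ R)[phi [cphi phi01 phi0 phi1]] := T_regular clB nBt.
exists phi; split => //.
- by move=> s; have := phi01 (phi s) (ex_intro2 _ _ s I erefl); rewrite /= in_itv.
- by apply: phi0; exists t.
- by move=> s Vs; apply: phi1; exists s => //= /interior_subset.
Qed.

Section minorants.
Variables (u : T -> R) (m e : R).
Hypothesis (mu : forall t, m <= u t) (e0 : 0 < e).

Definition minorant (h : T -> R) := continuous h /\ forall t, h t <= u t + e.

Definition minorants : directedType.
Proof.
apply: (@DirectedType {h | minorant h}
  (fun h k => forall t, projT1 h t <= projT1 k t)).
- constructor; exists (cst m); split; first exact: cst_continuous.
  by move=> t; rewrite (le_trans (mu t))// lerDl ltW.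
- by move=> h t.
- by move=> k h i hk ki t; exact: le_trans (hk t) (ki t).
- move=> [h [ch hu]] [k [ck ku]].
  have hk : minorant (h \max k).
    split; first by move=> t; apply: continuous_max; [exact: ch|exact: ck].
    by move=> t; rewrite /= ge_max hu ku.
  by exists (exist minorant _ hk) => t /=; rewrite le_max lexx ?orbT.
Defined.

End minorants.

(* Minorants are directed by max, and each t has a neighbourhood on which all
   large minorants exceed l - e; by compactness one of them works everywhere. *)
Lemma approximate_insertion (l u : T -> R) (m e : R) :
  (forall t c, l t < c -> \forall s \near t, l s < c) ->
  (forall t c, c < u t -> \forall s \near t, c < u s) ->
  (forall t, m <= l t) -> (forall t, l t <= u t) -> 0 < e ->
  exists2 h : T -> R, continuous h & forall t, l t - e <= h t <= u t + e.
Proof.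
move=> l_usc u_lsc ml lu e0.
have mu t : m <= u t by exact: le_trans (ml t) (lu t).
pose D := minorants mu e0.
(* Compactness in near-covering form, with the tails of the directed set of minorants as filter:
   local statements about all large minorants become one global statement. *)
have /compact_near_coveringP/(_ D (tails D)
  (fun h s => l s - e <= projT1 h s)) := T_compact.
case=> [t _|[h [ch hu]] _ lh]; last first.
  exists h => // t; rewrite hu andbT.
  exact: (lh (exist (minorant u e) h (conj ch hu)) (@dir_refl D _) t I).
have e20 : 0 < e / 2 by rewrite divr_gt0.
have tV : \forall s \near t, l t - e < u s.
  by apply: u_lsc; apply: lt_le_trans (lu t); rewrite ltrBlDr ltrDl.
have [phi [cphi phi01 phi0 phi1]] := separating_function tV.
(* [h0] equals [l t] at [t], never exceeds it, and drops to [m] off the set where [l t - e < u];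
   hence it is a minorant. *)
pose h0 s := l t - phi s * (l t - m).
have ch0 : continuous h0.
  move=> s; apply: cvgB; first exact: cvg_cst.
  by apply: cvgMl; exact: cphi.
have h0u s : h0 s <= u s + e.
  have [Vs|Vs] := pselect (l t - e < u s).
    have : 0 <= phi s * (l t - m).
      by have /andP[p0 _] := phi01 s; rewrite mulr_ge0// subr_ge0.
    rewrite /h0; lra.
  rewrite /h0 phi1//; have := mu s; lra.
exists ([set s | l s < l t + e / 2 /\ l t - e / 2 < h0 s],
  [set h : D | forall s, h0 s <= projT1 h s]).
  split; last by exists (exist (minorant u e) h0 (conj ch0 h0u)).
  apply: filterI; first by apply: l_usc; rewrite ltrDl.
  have := ch0 t; rewrite /continuous_at => /cvgr_gt; apply.
  by rewrite /h0 phi0 mul0r subr0 ltrBlDr ltrDl.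
move=> [s h] [/= [ls hs] hh]; have := hh s; lra.
Qed.

(** Approximate insertion with tolerance [e / 2] is applied between [max (l, h - e)] and
    [min (u, h + e)]. These are still semicontinuous because [h] is continuous, and in the right
    order by the bounds on [h]. The result is within [e + e / 2] of [h]. *)
Lemma refine_insertion (l u h : T -> R) (m e : R) :
  (forall t c, l t < c -> \forall s \near t, l s < c) ->
  (forall t c, c < u t -> \forall s \near t, c < u s) ->
  (forall t, m <= l t) -> (forall t, l t <= u t) -> 0 < e ->
  continuous h -> (forall t, l t - e <= h t <= u t + e) ->
  exists k : T -> R, [/\ continuous k,
    (forall t, l t - e / 2 <= k t <= u t + e / 2) &
    forall t, `|k t - h t| <= 2 * e].
Proof.
move=> l_usc u_lsc ml lu e0 ch hlu.
have [|||||k ck kb] := @approximate_insertion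
  (fun t => Num.max (l t) (h t - e)) (fun t => Num.min (u t) (h t + e)) m (e / 2).
- move=> t c; rewrite gt_max => /andP[ltc htc]; near=> s.
  rewrite gt_max; apply/andP; split; near: s; first exact: l_usc.
  rewrite ltrBlDr in htc; have /cvgr_lt/(_ _ htc) := ch t.
  by apply: filterS => s /=; rewrite ltrBlDr.
- move=> t c; rewrite lt_min => /andP[utc htc]; near=> s.
  rewrite lt_min; apply/andP; split; near: s; first exact: u_lsc.
  rewrite -ltrBlDr in htc; have /cvgr_gt/(_ _ htc) := ch t.
  by apply: filterS => s /=; rewrite -ltrBlDr.
- by move=> t; rewrite le_max ml.
- move=> t; have /andP[h1 h2] := hlu t.
  rewrite ge_max !le_min lu/=; lra.
- by rewrite divr_gt0.
have kb' t : [/\ l t <= k t + e / 2, h t - e <= k t + e / 2,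
    k t - e / 2 <= u t & k t - e / 2 <= h t + e].
  have /andP[] := kb t; rewrite lerBlDr ge_max => /andP[? ?].
  by rewrite -lerBlDr le_min => /andP[].
exists k; split => // t; have [k1 k2 k3 k4] := kb' t; first lra.
rewrite ler_norml; lra.
Unshelve. all: by end_near. Qed.

(* Katetov-Tong. The sequences h_n - 4 e_n and h_n + 4 e_n built in the proof are
   monotone, so that the supremum of the former is a uniform limit of h_n. *)
Lemma insertion (l u : T -> R) (m : R) :
  (forall t c, l t < c -> \forall s \near t, l s < c) ->
  (forall t c, c < u t -> \forall s \near t, c < u s) ->
  (forall t, m <= l t) -> (forall t, l t <= u t) ->
  exists2 h : T -> R, continuous h & forall t, l t <= h t <= u t.
Proof.
move=> l_usc u_lsc ml lu.
(* A state pairs a tolerance with an approximate solution for it; each refinement halves the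
   tolerance. *)
pose S := {p : R * (T -> R) | [/\ 0 < p.1, continuous p.2 &
  forall t, l t - p.1 <= p.2 t <= u t + p.1]}.
have [h0 ch0 h0b] := approximate_insertion l_usc u_lsc ml lu (@ltr01 R).
pose p0 : S := exist _ (1, h0) (And3 (@ltr01 R) ch0 h0b).
have [|F [F0 FS]] := @dependent_choice S (fun p q =>
  (projT1 q).1 = (projT1 p).1 / 2 /\
  forall t, `|(projT1 q).2 t - (projT1 p).2 t| <= 2 * (projT1 p).1) _ p0.
  move=> [[e h] /= [e0 ch hb]]; apply: cid.
  have [k [ck kb kh]] := refine_insertion l_usc u_lsc ml lu e0 ch hb.
  have e20 : 0 < e / 2 by rewrite divr_gt0.
  by exists (exist _ (e / 2, k) (And3 e20 ck kb)).
pose h n := (projT1 (F n)).2; pose e n := (projT1 (F n)).1.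
have ch n : continuous (h n) by have [] := projT2 (F n).
have hb n t : l t - e n <= h n t <= u t + e n by have [] := projT2 (F n).
have eE n : e n = 1 / 2 ^+ n.
  elim: n => [|n IH]; first by rewrite /e F0 expr0 divr1.
  by rewrite /e (FS n).1 -/(e n) IH exprSr invfM mulrA.
have e_small d : 0 < d -> exists n, e n < d.
  move=> d0; have [n _ /(_ n (leqnn n))] := near_infty_natSinv_expn_lt (PosNum d0).
  by rewrite /= -eE; exists n.
have hS n t : `|h n.+1 t - h n t| <= 2 * e n := (FS n).2 t.
have eS n : e n.+1 = e n / 2 := (FS n).1.
have e_gt0 n : 0 < e n by rewrite eE divr_gt0// exprn_gt0.
(* The factor 4 is chosen so that [4 * e n - 4 * e n.+1 = 2 * e n], which is exactly the bound on
   one increment of [h]. *)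
have p_homo t : {homo (fun n => h n t - 4 * e n) : i j / (i <= j)%N >-> i <= j}.
  apply/nondecreasing_seqP => n; rewrite eS.
  have := hS n t; rewrite ler_norml; lra.
have q_homo t : {homo (fun n => h n t + 4 * e n) : i j / (i <= j)%N >-> j <= i}.
  apply/nonincreasing_seqP => n; rewrite eS.
  have := hS n t; rewrite ler_norml; lra.
have pq t i j : h i t - 4 * e i <= h j t + 4 * e j.
  apply: le_trans (p_homo t _ _ (leq_maxl i j)) _.
  apply: le_trans (q_homo t _ _ (leq_maxr i j)).
  have := e_gt0 (maxn i j); lra.
pose g t := sup (range (fun n => h n t - 4 * e n)).
have gh n t : `|g t - h n t| <= 4 * e n.
  have : h n t - 4 * e n <= g t.
    apply: ub_le_sup; last by exists n.
    by exists (h 0%N t + 4 * e 0%N) => _ [i _ <-].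
  have : g t <= h n t + 4 * e n.
    by apply: ge_sup; [exists (h 0%N t - 4 * e 0%N), 0%N|move=> _ [i _ <-]].
  rewrite ler_norml; lra.
exists g.
  move=> t; apply/cvgrPdist_lt => d d0.
  (* Replacing [g] by [h n] at both points costs [8 * e n < 8 * d / 20], and continuity of [h n]
     costs another [d / 20]. *)
  have d20 : 0 < d / 20 by rewrite divr_gt0.
  have [n nd] := e_small _ d20.
  have /cvgrPdist_lt/(_ _ d20) := ch n t; apply: filterS => s.
  have := gh n t; have := gh n s; rewrite !ler_norml !ltr_norml; lra.
move=> t; apply/andP; split; apply/ler_addgt0Pr => d d0.
  (* The distance [4 * e n] from [g] to [h n] and the tolerance [e n] of [h n] add up to
     [5 * e n]. *)
  have [|n nd] := e_small (d / 5); first by rewrite divr_gt0.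
  have := gh n t; have := hb n t; rewrite ler_norml; lra.
have [|n nd] := e_small (d / 5); first by rewrite divr_gt0.
have := gh n t; have := hb n t; rewrite ler_norml; lra.
Qed.

End insertion.

(** * Limits superior of bounded real sequences *)

Section limsup.
Variables (R : realType) (u : nat -> R) (B : R).
Hypothesis uB : forall n, `|u n| <= B.

Lemma limn_sup_infE : limn_sup u = inf (range (sups u)).
Proof.
by apply/cvg_lim => //; apply: cvg_sups_inf; [exists B|exists (- B)];
  move=> _ [n _ <-]; have := uB n; rewrite ler_norml => /andP[].
Qed.

Lemma has_ubound_sdrop_le n : has_ubound (sdrop u n).
Proof. by exists B => _ [j _ <-]; exact: le_trans (ler_norm _) (uB _). Qed.

Lemma has_lbound_sups : has_lbound (range (sups u)).
Proof.
exists (- B) => _ [n _ <-]; apply: (@le_trans _ _ (u n)).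
  by have := uB n; rewrite ler_norml => /andP[].
by apply: (ub_le_sup (has_ubound_sdrop_le n)); exists n => /=.
Qed.

Lemma limn_sup_le c : (\forall n \near \oo, u n <= c) -> limn_sup u <= c.
Proof.
move=> [n _ nc]; rewrite limn_sup_infE; apply: (@le_trans _ _ (sups u n)).
  by apply: (ge_inf has_lbound_sups); exists n.
apply: ge_sup; first by exists (u n), n => /=.
by move=> _ [j /= nj <-]; exact: nc.
Qed.

Lemma limn_sup_lt c : limn_sup u < c -> \forall n \near \oo, u n < c.
Proof.
rewrite limn_sup_infE => /inf_lt[|_ [n _ <-] nc].
  by exists (sups u 0%N), 0%N.
exists n => // j /= nj; apply: le_lt_trans nc.
by apply: (ub_le_sup (has_ubound_sdrop_le n)); exists j.
Qed.

End limsup.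

Lemma continuous_sup_bounded (R : realType) (T : topologicalType) (g : T -> R) :
  compact [set: T] -> continuous g -> sup_bounded g.
Proof.
move=> cT cg; have /compact_bounded[B [_ gB]] : compact (g @` setT).
  by apply: continuous_compact => //; exact: continuous_subspaceT.
exists (`|B| + 1) => t; apply: (gB (`|B| + 1)); last by exists t.
by rewrite (le_lt_trans (ler_norm B))// ltrDl.
Qed.

Lemma sup_boundedB (R : realType) (T : Type) (g h : T -> R) :
  sup_bounded g -> sup_bounded h -> sup_bounded (g \- h).
Proof.
move=> [A gA] [B hB]; exists (A + B) => t /=.
by rewrite (le_trans (ler_normB _ _))// lerD.
Qed.

(** * The limsup distance formula on a compact space *)

Section compact_envelopes.
Variables (R : realType) (K : topologicalType) (f : nat -> K -> R) (M : R).
Hypotheses (K_compact : compact [set: K]) (fM : forall n t, `|f n t| <= M).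

Let NfM n t : `|- f n t| <= M. Proof. by rewrite normrN. Qed.

Local Notation a := (lower_envelope f).
Local Notation b := (upper_envelope f).

Lemma near_lower_envelope t c : c < a t ->
  \forall s \near t & j \near \oo, c <= f j s.
Proof.
rewrite (lower_envelopeE fM) ltrNr => /(near_upper_envelope NfM).
by apply: filterS => -[s j] /=; rewrite lerN2.
Qed.

Lemma lower_envelope_ge t c :
  (\forall s \near t & j \near \oo, c <= f j s) -> c <= a t.
Proof.
move=> fc; rewrite (lower_envelopeE fM) lerNr; apply: (upper_envelope_le NfM).
by apply: filterS fc => -[s j] /=; rewrite lerN2.
Qed.

Lemma near_lower_envelope_gt t c : c < a t -> \forall s \near t, c < a s.
Proof.
rewrite (lower_envelopeE fM) ltrNr => /(near_upper_envelope_lt NfM).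
by apply: filterS => s; rewrite (lower_envelopeE fM) [_ < - c]ltrNr.
Qed.

Lemma lower_envelope_bounds t : - M <= a t <= M.
Proof.
rewrite (lower_envelopeE fM); have := upper_envelope_bounds NfM t; lra.
Qed.

Lemma upper_envelope_sup_bounded : sup_bounded b.
Proof. by exists M => t; rewrite ler_norml (upper_envelope_bounds fM). Qed.

Lemma lower_envelope_sup_bounded : sup_bounded a.
Proof. by exists M => t; rewrite ler_norml lower_envelope_bounds. Qed.

(** If [b t < a t], take [b t < c < d < a t]: for [s] near [t] and [j] large, both [f j s <= c] and
    [d <= f j s] would hold. Two thresholds are used because the local bounds are not strict. *)
Lemma lower_le_upper t : a t <= b t.
Proof.
rewrite leNgt; apply/negP => ba; pose c := (a t + b t) / 2.
have [bc ca] : b t < c /\ c < a t by rewrite /c; split; lra.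
pose d := (c + a t) / 2.
have [cd da] : c < d /\ d < a t by rewrite /d; split; lra.
have [[s j] /= [h1 h2]] := filter_ex (filterI (near_upper_envelope fM bc)
  (near_lower_envelope da)).
by have := le_trans h2 h1; rewrite leNgt cd.
Qed.

Lemma limsup_distE (g : K -> R) : continuous g ->
  limn_sup (fun n => supnorm (f n \- g)) =
  Num.max (supnorm (b \- g)) (supnorm (g \- a)).
Proof.
move=> cg; have bg := continuous_sup_bounded K_compact cg.
have [G gG] := bg.
have bfg n : sup_bounded (f n \- g) by apply: sup_boundedB => //; exists M.
have dB n : `|supnorm (f n \- g)| <= `|M| + `|G|.
  rewrite ger0_norm ?supnorm_ge0//; apply: supnorm_le => [|t]; first exact: addr_ge0.
  rewrite /= (le_trans (ler_normB _ _))// lerD// ?(le_trans (fM n t))//.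
    exact: ler_norm.
  by rewrite (le_trans (gG t))// ler_norm.
have bbg : sup_bounded (b \- g).
  exact: sup_boundedB upper_envelope_sup_bounded bg.
have bga : sup_bounded (g \- a).
  exact: sup_boundedB bg lower_envelope_sup_bounded.
apply/eqP; rewrite eq_le; apply/andP; split.
  set m := Num.max _ _; apply/ler_addgt0Pr => d d0.
  apply: (limn_sup_le dB).
  (* Near each [t] and for large [n], [f n] lies between [a t - d / 2] and [b t + d / 2] up to the
     variation of [g], controlled by another [d / 2]; the covering argument makes the threshold on
     [n] uniform. *)
  have := K_compact; move=> /compact_near_coveringP/(_ nat \oo
    (fun n s => `|f n s - g s| <= m + d)); case => [t _|N _ Nf].
    have bt : b t < g t + m + d / 2.
      have : b t - g t <= m.
        by rewrite /m le_max (le_trans (ler_norm _) (supnorm_ge t bbg)).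
      lra.
    have at_ : g t - m - d / 2 < a t.
      have : g t - a t <= m.
        by rewrite /m le_max (le_trans (ler_norm _) (supnorm_ge t bga)) orbT.
      lra.
    have d20 : 0 < d / 2 by rewrite divr_gt0.
    have /cvgrPdist_lt/(_ _ d20) gt := cg t.
    have gtj : \forall s \near t & j \near \oo, `|g t - g s| < d / 2.
      exists ([set s | `|g t - g s| < d / 2], setT); last by case=> s j [].
      by split => //; exact: filterT.
    apply: filterS (filterI gtj (filterI (near_upper_envelope fM bt)
      (near_lower_envelope at_))) => -[s j] /= [+ [h1 h2]].
    rewrite ltr_norml ler_norml; lra.
  exists N => // n /= Nn; apply: supnorm_le => [|t].
    by rewrite addr_ge0 ?(ltW d0)// /m le_max supnorm_ge0.
  exact: (Nf n Nn t I).
set rho := limn_sup _.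
have rho_ge0 : 0 <= rho.
  rewrite leNgt; apply/negP => /(limn_sup_lt dB)[N _ /(_ N (leqnn N))].
  by rewrite ltNge supnorm_ge0.
(* One-sided bounds suffice for both norms, since [a <= b] gives [g - b <= g - a] and
   [a - g <= b - g]. *)
have key t : b t - g t <= rho /\ g t - a t <= rho.
  have near_fg d : 0 < d -> \forall s \near t & j \near \oo,
      `|f j s - g t| <= rho + d.
    move=> d0; have d20 : 0 < d / 2 by rewrite divr_gt0.
    have /cvgrPdist_lt/(_ _ d20) gt := cg t.
    have fj : \forall j \near \oo, supnorm (f j \- g) < rho + d / 2.
      by apply: (limn_sup_lt dB); rewrite ltrDl.
    exists ([set s | `|g t - g s| < d / 2],
      [set j | supnorm (f j \- g) < rho + d / 2]); first by [].
    move=> [s j] [/= gs fs]; have := supnorm_ge s (bfg j).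
    move: gs; rewrite /= ltr_norml !ler_norml; lra.
  split; apply/ler_addgt0Pr => d d0.
    rewrite lerBlDl addrA; apply: (upper_envelope_le fM).
    apply: filterS (near_fg d d0) => -[s j] /=; rewrite ler_norml; lra.
  rewrite lerBlDl -lerBlDr; apply: lower_envelope_ge.
  apply: filterS (near_fg d d0) => -[s j] /=; rewrite ler_norml; lra.
rewrite ge_max; apply/andP; split; apply: supnorm_le => // t /=;
  have [] := key t; have := lower_le_upper t; rewrite ler_norml; lra.
Qed.

End compact_envelopes.

(** * Functions in [C0] as continuous functions on the compactification *)

Section one_point.
Variables (R : realType) (L : topologicalType).
Let K := one_point_compactification L.

(** At infinity, the level set [e <= |g|] is closed and compact, so its complement is a
    neighbourhood of infinity on which the extension is smaller than [e]. *)
Lemma zero_at_infinity_continuous (g : C0 R L) :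
  continuous (zero_at_infinity g : K -> R).
Proof.
have := C0_valP g; rewrite inE => -[cg vg].
suff g0 : zero_at_infinity g @ nbhs (None : K) --> (0 : R).
  by move=> [t|]; [exact: cg|exact: g0].
apply/cvgrPdist_lt => e e0.
exists [set t | e <= `|g t|].
  split; first exact: vg.
  have -> : [set t | e <= `|g t|] = (fun t => `|g t|) @^-1` [set x : R | e <= x].
    by [].
  apply: closed_comp; last exact: closed_ge.
  by move=> t _; apply: continuous_comp; [exact: cg|exact: norm_continuous].
move=> [t|] /=; last by rewrite subrr normr0.
case=> [[s /= gs [<-]]|//].
by rewrite sub0r normrN ltNge; exact/negP.
Qed.

(** A neighbourhood of infinity on which [|h| < e] omits only points of a compact [W]; the closed
    level set lies inside [W]. *)
Lemma restriction_C0 (h : K -> R) : continuous h -> h None = 0 ->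
  h \o Some \in @C0_pred R L.
Proof.
move=> ch h0; rewrite inE.
have chS : continuous (h \o Some) by move=> t; exact: (ch (Some t)).
split=> // e e0.
have /cvgrPdist_lt/(_ _ e0) [W [cW _] WU] := ch None.
apply: (@subclosed_compact _ _ W _ cW).
  have -> : [set t | e <= `|(h \o Some) t|] =
      (fun t => `|(h \o Some) t|) @^-1` [set x : R | e <= x] by [].
  apply: closed_comp; last exact: closed_ge.
  by move=> t _; apply: continuous_comp; [exact: chS|exact: norm_continuous].
move=> t /= eh; apply: contrapT => Wt.
have /= := WU (Some t) (or_introl (ex_intro2 _ _ t Wt erefl)).
by rewrite h0 sub0r normrN ltNge eh.
Qed.

Lemma supnorm_zero_at_infinity (g h : C0 R L) :
  supnorm ((zero_at_infinity g : K -> R) \- zero_at_infinity h) = `|g - h|.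
Proof.
have bgh : sup_bounded (g - h : C0 R L) := C0_bounded _.
apply/eqP; rewrite eq_le; apply/andP; split; apply: supnorm_le.
- exact: normr_ge0.
- move=> [t|] /=; last by rewrite subrr normr0.
  exact: (supnorm_ge t bgh).
- exact: supnorm_ge0.
- move=> t; apply: (@supnorm_ge R K _ (Some t)).
  have [B ghB] := bgh; exists B => -[s|] /=; first exact: ghB.
  by rewrite subrr normr0; exact: le_trans (ghB t).
Qed.

End one_point.

(** * Asymptotic radius and center of a bounded sequence in [C0] *)

Theorem theorem2p4 (R : realType) (L : topologicalType)
    (L_loc_compact : locally_compact [set: L])
    (L_noncompact : ~ compact [set: L])
    (L_hausdorff : hausdorff_space L)
    (f : nat -> C0 R L) (f_bounded : bounded_fun f) :
  let K := one_point_compactification L in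
  let oo : K := None in
  let fK : nat -> K -> R := fun n => zero_at_infinity (f n) in
  let a : K -> R := lower_envelope fK in
  let b : K -> R := upper_envelope fK in
  let r : R := Num.max (Num.max (b oo) (- a oo)) (2^-1 * supnorm (b \- a)) in
  let C : set (C0 R L) :=
    [set g : C0 R L |
       let gK : K -> R := zero_at_infinity g in
       Num.max (supnorm (b \- gK)) (supnorm (gK \- a)) = r] in
  [/\ lower_semicontinuous (EFin \o a),
      upper_semicontinuous (EFin \o b),
      forall g : K -> R, continuous g ->
        limn_sup (fun n => supnorm (fK n \- g)) =
        Num.max (supnorm (b \- g)) (supnorm (g \- a)),
      asymptotic_radius f = r &
      asymptotic_center f = C /\ C !=set0].
Proof.
move=> K oo fK a b r C.
have [M fM] : exists M, forall n t, `|fK n t| <= M.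
  have [B [_ fB]] := f_bounded.
  have fB1 n : `|f n| <= `|B| + 1.
    by apply: (fB (`|B| + 1)) => //; rewrite (le_lt_trans (ler_norm B))// ltrDl.
  exists (`|B| + 1) => n [t|] /=; last by rewrite normr0 addr_ge0.
  exact: le_trans (supnorm_ge t (C0_bounded (f n))) (fB1 n).
have K_compact : compact [set: K] := one_point_compactification_compact.
have dist_fE (g : K -> R) : continuous g ->
  limn_sup (fun n => supnorm (fK n \- g)) =
  Num.max (supnorm (b \- g)) (supnorm (g \- a)).
  by move=> cg; exact: (limsup_distE K_compact fM cg).
pose Phi (g : C0 R L) := Num.max (supnorm (b \- (zero_at_infinity g : K -> R)))
  (supnorm ((zero_at_infinity g : K -> R) \- a)).
have distE (g : C0 R L) : limn_sup (fun n => `|f n - g|) = Phi g.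
  rewrite /Phi -dist_fE; last exact: zero_at_infinity_continuous.
  by congr limn_sup; apply/funext => n; rewrite supnorm_zero_at_infinity.
have bb : sup_bounded b := upper_envelope_sup_bounded fM.
have ba : sup_bounded a := lower_envelope_sup_bounded fM.
have bba : sup_bounded (b \- a) by exact: sup_boundedB.
have ab t : a t <= b t := lower_le_upper fM t.
have r_le g : r <= Phi g.
  have bg : sup_bounded (zero_at_infinity g : K -> R).
    by apply: continuous_sup_bounded => //; exact: zero_at_infinity_continuous.
  have b_le t : b t - zero_at_infinity g t <= Phi g.
    by rewrite /Phi le_max (le_trans (ler_norm _) (supnorm_ge t (sup_boundedB bb bg))).
  have a_le t : zero_at_infinity g t - a t <= Phi g.
    by rewrite /Phi le_max (le_trans (ler_norm _) (supnorm_ge t (sup_boundedB bg ba)))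
      orbT.
  rewrite /r !ge_max; apply/andP; split; first apply/andP; first split.
  - by have := b_le oo; rewrite subr0.
  - by have := a_le oo; rewrite sub0r.
  - rewrite mulrC ler_pdivrMr//; apply: supnorm_le => [|t].
      by rewrite mulr_ge0// /Phi le_max supnorm_ge0.
    have := ab t; have := a_le t; have := b_le t.
    rewrite /= ler_norml; lra.
have [br ar bar] : [/\ b oo <= r, - a oo <= r & forall t, b t - a t <= 2 * r].
  split; rewrite /r ?le_max ?lexx ?orbT// => t.
  rewrite mulrC -ler_pdivrMr// mulrC /r le_max; apply/orP; right.
  by rewrite ler_pM2l ?invr_gt0// (le_trans (ler_norm _))// (supnorm_ge t bba).
have r0 : 0 <= r by rewrite /r le_max mulr_ge0 ?invr_ge0 ?supnorm_ge0 ?orbT.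
have [g gr] : exists g, Phi g = r.
  pose l (t : K) := if t is Some _ then b t - r else 0.
  pose u (t : K) := if t is Some _ then a t + r else 0.
  have lE t : l (Some t) = b (Some t) - r by [].
  have uE t : u (Some t) = a (Some t) + r by [].
  have [||||h ch lhu] := @insertion R K K_compact
    (@one_point_compactification_completely_reg L R L_loc_compact L_hausdorff)
    (* [- M - r] bounds [l] below: [- M <= b] on [L], and at infinity both [M] and [r] are
       nonnegative. *)
    l u (- M - r).
  - have near_l t c : b t - r < c -> (\forall s \near t, b s - r < c).
      rewrite ltrBlDr => /(near_upper_envelope_lt fM).
      by apply: filterS => s; rewrite ltrBlDr.
    move=> [t|] c.
      rewrite lE => /near_l; exact.
    (* Here [b oo - r <= 0], so [l] arises from [b - r] by raising the value at infinity; a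
       neighbourhood on which [b - r < c] still serves, as [0 < c]. *)
    rewrite [l _]/= => c0; have /near_l : b oo - r < c by lra.
    by apply: filterS => -[s|] //=.
  - have near_u t c : c < a t + r -> (\forall s \near t, c < a s + r).
      rewrite -ltrBlDr => /(near_lower_envelope_gt fM).
      by apply: filterS => s; rewrite -ltrBlDr.
    move=> [t|] c.
      rewrite uE => /near_u; exact.
    rewrite [u _]/= => c0; have /near_u : c < a oo + r by lra.
    by apply: filterS => -[s|] //=.
  - have Mb t : - M <= b t <= M := upper_envelope_bounds fM t.
    move=> [t|]; last by have := Mb oo; rewrite [l _]/=; lra.
    have := Mb (Some t); rewrite lE; lra.
  - by move=> [t|] //; have := bar (Some t); rewrite lE uE; lra.
  (* [l] and [u] are both 0 at infinity, which pins [h] there. *)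
  have h0 : h oo = 0 by have := lhu oo; rewrite /l /u /= -eq_le => /eqP.
  pose g := MkC0 (restriction_C0 ch h0).
  have gh : (zero_at_infinity g : K -> R) = h by apply/funext => -[].
  exists g; apply/eqP; rewrite eq_le r_le andbT /Phi gh ge_max.
  (* At infinity the original bounds hold as well, because [b oo <= r] and [- a oo <= r]. *)
  have bh t : b t - r <= h t <= a t + r.
    case: t => [t|]; first exact: (lhu (Some t)).
    by rewrite h0; lra.
  apply/andP; split; apply: supnorm_le => // t /=;
    have := ab t; have := bh t; rewrite ler_norml; lra.
have radE : asymptotic_radius f = r.
  apply/eqP; rewrite eq_le; apply/andP; split.
    rewrite -gr -distE; apply: ge_inf; last by exists g.
    by exists r => _ [h _ <-]; rewrite distE.
  apply: lb_le_inf; first by exists (limn_sup (fun n => `|f n - g|)), g.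
  by move=> _ [h _ <-]; rewrite distE.
split => //.
- move=> t c; rewrite /= lte_fin => /(near_lower_envelope_gt fM) atc.
  by eexists; first exact: atc.
- move=> t c; rewrite /= lte_fin => /(near_upper_envelope_lt fM) btc.
  by eexists; first exact: btc.
- split; last by exists g.
  apply/seteqP; split => h.
    by rewrite /asymptotic_center /= distE radE.
  by rewrite /asymptotic_center /= distE radE.
Qed.
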